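(* Let $\mu$ be a measure. Then the space $L_1(\mu)$ has the coarse $1$-Gelfand-Phillips property if and only if $L_1(\mu)$ has the Schur property.
   Context: A subset $A$ of a Banach space $X$ is coarse $1$-limited if $T(A)$ is a relatively compact subset of $\ell_1$ for every bounded linear operator $T: X \to \ell_1$. A Banach space $X$ has the coarse $1$-Gelfand-Phillips property if every coarse $1$-limited subset of $X$ is relatively compact (in norm). A Banach space has the Schur property if every weakly null sequence in it is norm null. *)

(* Defs.v *)
From HB Require Import structures.
From mathcomp Require Import all_boot all_order all_algebra.
From mathcomp Require Import all_classical all_reals all_analysis.
From mathcomp Require Import measurable_realfun.

Set Implicit Arguments.
Unset Strict Implicit.
Unset Printing Implicit Defensive.

Import Order.TTheory GRing.Theory Num.Theory.
Import numFieldNormedType.Exports.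

Local Open Scope classical_set_scope.
Local Open Scope ring_scope.

(* Banach space structure on [LspaceType1 mu], the measurable functions with
   finite L1-norm modulo mu-a.e. equality; an element coerces to one of its
   representatives, so identities between elements hold only mu-a.e. *)
Section L1_space.
Context d (T : measurableType d) (R : realType).
Variable mu : {measure set T -> \bar R}.

Local Notation L1 := (LspaceType1 mu).

HB.instance Definition _ := gen_eqMixin L1.
HB.instance Definition _ := gen_choiceMixin L1.

Lemma L1_val_inj (f g : L1) :
  LebesgueSpace.sort f = LebesgueSpace.sort g -> f = g.
Proof.
case: f => f [[pf]]; case: g => g [[pg]] /= fg.
by rewrite -fg in pg *; rewrite (Prop_irrelevance pf pg).
Qed.

Lemma L1_eq (f g : L1) : (f : T -> R) = g %[ae mu] -> f = g.
Proof.
move=> fg; apply/L1_val_inj.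
rewrite -[LebesgueSpace.sort f]reprK -[LebesgueSpace.sort g]reprK.
by apply/eqmodP/asboolP; exact: fg.
Qed.

Lemma L1_integrable (f : L1) : mu.-integrable [set: T] (EFin \o f).
Proof.
apply/Lfun1_integrable; rewrite inE; apply/andP; split; rewrite inE/=.
  exact: (@measurable_funPT _ _ _ _ (repr (LebesgueSpace.sort f))).
exact: Lebesgue_finite.
Qed.

Section L1_of.
Variables (f : T -> R) (intf : mu.-integrable [set: T] (EFin \o f)).

Let mf : @measurable_fun _ _ T (measurableTypeR R) [set: T] f.
Proof. by move/integrableP : intf => [/measurable_EFinP]. Qed.

Let mfunf : {mfun T >-> measurableTypeR R} :=
  @mfun_Sub _ _ T (measurableTypeR R) f (mem_set mf).

Let cls : {mfun_ mu, T >-> measurableTypeR R} := \pi%qT mfunf.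

Let cls_ae : (cls : T -> R) = f %[ae mu].
Proof.
have : (repr cls == mfunf %[mod {mfun_ mu, T >-> measurableTypeR R}])%qT.
  by rewrite reprK.
by rewrite eqmodE => /asboolP.
Qed.

Let cls_finite : finite_norm mu 1 cls.
Proof.
rewrite /finite_norm Lnorm1; case/integrableP : intf => _.
apply: le_lt_trans; rewrite le_eqVlt; apply/orP; left; apply/eqP.
apply: ae_eq_integral => //.
- apply: measurableT_comp => //; apply/measurable_EFinP.
  exact: (@measurable_funPT _ _ _ _ (repr cls)).
- by apply: measurableT_comp => //; exact/measurable_EFinP.
- by apply: filterS cls_ae => x /= /[apply] ->.
Qed.

Definition L1_of : L1 := LebesgueSpace.Pack
  (LebesgueSpace.Class (isFinLebesgue.Build _ _ _ _ _ _ _ cls_finite)).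

Lemma L1_ofE : (L1_of : T -> R) = f %[ae mu].
Proof. exact: cls_ae. Qed.

End L1_of.

Lemma L1_of_eq (f : L1) (g : T -> R)
    (intg : mu.-integrable [set: T] (EFin \o g)) :
  (f : T -> R) = g %[ae mu] -> L1_of intg = f.
Proof.
by move=> fg; apply/L1_eq/(ae_eq_trans (L1_ofE intg))/ae_eq_sym.
Qed.

Let integrable_add (f g : L1) : mu.-integrable [set: T] (EFin \o (f \+ g)).
Proof. exact: (integrableD _ (L1_integrable f) (L1_integrable g)). Qed.

Let integrable_opp (f : L1) : mu.-integrable [set: T] (EFin \o (\- f)).
Proof. exact: integrableN (L1_integrable f). Qed.

Let integrable_scale a (f : L1) :
  mu.-integrable [set: T] (EFin \o (fun x => a * f x)).
Proof. exact: integrableZl (L1_integrable f). Qed.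

Let integrable_zero : mu.-integrable [set: T] (EFin \o cst 0).
Proof. exact: integrable0. Qed.

Let add (f g : L1) := L1_of (integrable_add f g).
Let opp (f : L1) := L1_of (integrable_opp f).
Let scale a (f : L1) := L1_of (integrable_scale a f).
Let zero := L1_of integrable_zero.

Let addE f g : (add f g : T -> R) = f \+ g %[ae mu].
Proof. exact: L1_ofE. Qed.
Let oppE f : (opp f : T -> R) = \- f %[ae mu].
Proof. exact: L1_ofE. Qed.
Let scaleE a f : (scale a f : T -> R) = (fun x => a * f x) %[ae mu].
Proof. exact: L1_ofE. Qed.
Let zeroE : (zero : T -> R) = cst 0 %[ae mu].
Proof. exact: L1_ofE. Qed.

Let addA : associative add.
Proof.
move=> f g h; apply: L1_eq.
near=> x => _; rewrite (near (addE f (add g h)) x)//= (near (addE g h) x)//=.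
by rewrite (near (addE (add f g) h) x)//= (near (addE f g) x)//= addrA.
Unshelve. all: by end_near. Qed.

Let addC : commutative add.
Proof.
move=> f g; apply: L1_eq; move: (addE f g) (addE g f).
by apply: filterS2 => x /(_ I) /= -> /(_ I) /= -> _; rewrite addrC.
Qed.

Let add0 : left_id zero add.
Proof.
move=> f; apply: L1_eq; move: (addE zero f) zeroE.
by apply: filterS2 => x /(_ I) /= -> /(_ I) /= -> _; rewrite add0r.
Qed.

Let addN : left_inverse zero opp add.
Proof.
move=> f; apply: L1_eq; move: (addE (opp f) f) (oppE f) zeroE.
by apply: filterS3 => x /(_ I) /= -> /(_ I) /= -> /(_ I) /= -> _; rewrite addNr.
Qed.

HB.instance Definition _ := GRing.isZmodule.Build L1 addA addC add0 addN.

Let scaleA a b f : scale a (scale b f) = scale (a * b) f.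
Proof.
apply: L1_eq; move: (scaleE a (scale b f)) (scaleE b f) (scaleE (a * b) f).
by apply: filterS3 => x /(_ I) /= -> /(_ I) /= -> /(_ I) /= -> _; rewrite mulrA.
Qed.

Let scale1 : left_id 1 scale.
Proof.
move=> f; apply: L1_eq; move: (scaleE 1 f).
by apply: filterS => x /(_ I) /= -> _; rewrite mul1r.
Qed.

Let scaleDr : right_distributive scale +%R.
Proof.
move=> a f g; apply: L1_eq.
near=> x => _; rewrite (near (scaleE a (add f g)) x)//= (near (addE f g) x)//=.
rewrite (near (addE (scale a f) (scale a g)) x)//= (near (scaleE a f) x)//=.
by rewrite (near (scaleE a g) x)//= mulrDr.
Unshelve. all: by end_near. Qed.

Let scaleDl f : {morph scale^~ f : a b / a + b}.
Proof.
move=> a b; apply: L1_eq.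
near=> x => _; rewrite (near (scaleE (a + b) f) x)//=.
rewrite (near (addE (scale a f) (scale b f)) x)//= (near (scaleE a f) x)//=.
by rewrite (near (scaleE b f) x)//= mulrDl.
Unshelve. all: by end_near. Qed.

HB.instance Definition _ :=
  GRing.Zmodule_isLmodule.Build R L1 scaleA scale1 scaleDr scaleDl.

Lemma L1_addE (f g : L1) : ((f + g : L1) : T -> R) = f \+ g %[ae mu].
Proof. exact: addE. Qed.

Lemma L1_oppE (f : L1) : ((- f : L1) : T -> R) = \- f %[ae mu].
Proof. exact: oppE. Qed.

Lemma L1_subE (f g : L1) : ((f - g : L1) : T -> R) = f \- g %[ae mu].
Proof.
move: (L1_addE f (- g)) (L1_oppE g).
by apply: filterS2 => x /(_ I) /= -> /(_ I) /= -> _.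
Qed.

Lemma L1_scaleE a (f : L1) : ((a *: f : L1) : T -> R) = (fun x => a * f x) %[ae mu].
Proof. exact: scaleE. Qed.

Lemma L1_zeroE : ((0 : L1) : T -> R) = cst 0 %[ae mu].
Proof. exact: zeroE. Qed.

Lemma measurable_L1 (f : L1) : measurable_fun [set: T] (f : T -> R).
Proof. by have /integrableP[/measurable_EFinP] := L1_integrable f. Qed.

Definition L1_norm (f : L1) : R := fine ('N[mu]_1[EFin \o f])%E.

Lemma L1_normE (f : L1) : (L1_norm f)%:E = (\int[mu]_x `|(f x)%:E|)%E.
Proof.
rewrite /L1_norm Lnorm1 fineK// ge0_fin_numE ?integral_ge0//.
by have /integrableP[] := L1_integrable f.
Qed.

Lemma eq_L1_norm (f : L1) (g : T -> R) : measurable_fun [set: T] g ->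
  (f : T -> R) = g %[ae mu] -> (L1_norm f)%:E = (\int[mu]_x `|(g x)%:E|)%E.
Proof.
move=> mg fg; rewrite L1_normE; apply: ae_eq_integral => //.
- by apply: measurableT_comp => //; exact/measurable_EFinP/measurable_L1.
- by apply: measurableT_comp => //; exact/measurable_EFinP.
- by apply: filterS fg => x /= /[apply] ->.
Qed.

Let normD (f g : L1) : L1_norm (f + g) <= L1_norm f + L1_norm g.
Proof.
have mf := measurable_L1 f; have mg := measurable_L1 g.
rewrite -lee_fin EFinD (eq_L1_norm _ (L1_addE f g)); last exact: measurable_funD.
by rewrite !L1_normE -!Lnorm1; exact: eminkowski.
Qed.

Let normZ a (f : L1) : L1_norm (a *: f) = `|a| * L1_norm f.
Proof.
have mf := measurable_L1 f.
apply: EFin_inj.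
rewrite (eq_L1_norm _ (L1_scaleE a f)); last exact: measurable_funM.
under eq_integral do rewrite EFinM abseM.
rewrite ge0_integralZl ?EFinM ?L1_normE//.
by apply: measurableT_comp => //; exact/measurable_EFinP.
Qed.

Let norm0_eq0 (f : L1) : L1_norm f = 0 -> f = 0.
Proof.
move=> f0; apply: L1_eq; have := L1_normE f; rewrite f0 => /esym.
have mf : measurable_fun [set: T] (EFin \o f).
  exact/measurable_EFinP/measurable_L1.
move/(ae_eq_integral_abs mu measurableT mf); move: L1_zeroE.
by apply: filterS2 => x /(_ I) /= -> /(_ I)[->].
Qed.

HB.instance Definition _ := Lmodule_isNormed.Build R L1 normD normZ norm0_eq0.

Lemma L1_norm_int (f : L1) : `|f|%:E = (\int[mu]_x `|(f x)%:E|)%E.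
Proof. exact: L1_normE. Qed.

Section limit.
Variable u : nat -> L1.
Hypothesis uC : forall n m, (n <= m)%N -> `|u n - u m| <= 2 * 2^-1 ^+ n.

Let measurable_u n : measurable_fun [set: T] (u n : T -> R).
Proof. exact: measurable_L1. Qed.

Let norm_sub n m : `|u n - u m|%:E = (\int[mu]_x `|(u n x - u m x)%:E|)%E.
Proof.
rewrite [LHS](eq_L1_norm _ (L1_subE (u n) (u m)))//.
exact: measurable_funB.
Qed.

Let h n (x : T) : \bar R := `|(u n.+1 x - u n x)%:E|%E.

Let mh n : measurable_fun [set: T] (h n).
Proof.
by apply: measurableT_comp => //; apply/measurable_EFinP/measurable_funB.
Qed.

Let ae_sum : {ae mu, forall x, (\sum_(n <oo) h n x < +oo)%E}.
Proof.
have mH : measurable_fun [set: T] (fun x => \sum_(n <oo) h n x)%E.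
  by apply: ge0_emeasurable_sum => // n x _ _; rewrite /h.
have H0 x : (0 <= \sum_(n <oo) h n x)%E by apply: nneseries_ge0 => n _ _; rewrite /h.
have : mu.-integrable [set: T] (fun x => \sum_(n <oo) h n x)%E.
  apply/integrableP; split => //.
  under eq_integral do rewrite gee0_abs//.
  rewrite integral_nneseries//; last by move=> n x _; rewrite /h.
  apply: (@le_lt_trans _ _ (\sum_(n <oo) (2 * 2^-1 ^+ n)%:E)%E).
    apply: lee_nneseries => [n _ _|n _]; first by apply: integral_ge0 => x _; rewrite /h.
    by rewrite /h -norm_sub distrC lee_fin uC.
  have := @cvg_geometric_eseries_half R 4 0.
  rewrite (_ : eseries _ = fun n => (\sum_(0 <= k < n) (2 * 2^-1 ^+ k)%:E)%E); last first.
    apply/funext => n; apply: eq_bigr => k _; congr EFin.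
    rewrite addn1 natrX exprS exprVn invfM mulrA; congr (_ * _).
    by rewrite -[4]/(2 * 2)%:R natrM mulfK.
  by move/cvg_lim => ->//; rewrite ltry.
move=> iH; have := integrable_ae measurableT iH.
by apply: filterS => x; rewrite ge0_fin_numE//; apply.
Qed.

Let lim_fun (x : T) : R := fine (limn_esup (fun n => (u n x)%:E)).

Let ae_cvg : {ae mu, forall x, (u n x)%:E @[n --> \oo] --> (lim_fun x)%:E}.
Proof.
apply: filterS ae_sum => x sx.
have : cvgn (series (telescope (fun n => u n x))).
  apply: (@normed_cvg R R^o).
  have H0 n : (0 <= h n x)%E by rewrite /h.
  apply: nondecreasing_is_cvgn.
    by apply/nondecreasing_series => k _ _; exact: normr_ge0.
  exists (fine (\sum_(n <oo) h n x)%E) => _ [n _ <-].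
  rewrite -lee_fin fineK; last by rewrite ge0_fin_numE// nneseries_ge0.
  rewrite /series/= -sumEFin.
  apply: le_trans (@nneseries_lim_ge _ (h ^~ x) xpredT 0%N n _); last by [].
  by rewrite le_eqVlt; apply/orP; left; apply/eqP/eq_bigr.
rewrite telescopeK => /cvg_ex[l ul].
have : (u n x)%:E @[n --> \oo] --> (l + u 0%N x)%:E.
  apply: cvg_EFin; first exact: nearW.
  rewrite (_ : _ \o _ = fun n => (u n x - u 0%N x) + u 0%N x).
    by apply: cvgD => //; exact: cvg_cst.
  by apply/funext => n /=; rewrite subrK.
by move=> ux; rewrite /lim_fun (cvg_limn_einf_sup ux).2.
Qed.

Let mlim : measurable_fun [set: T] lim_fun.
Proof.
apply: measurableT_comp => //.
by apply: measurable_fun_limn_esup => n; exact/measurable_EFinP.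
Qed.

Let int_lim n : (\int[mu]_x `|(u n x - lim_fun x)%:E| <= (2 * 2^-1 ^+ n)%:E)%E.
Proof.
rewrite (@ae_eq_integral _ _ _ mu _
  (fun x => limn_einf (fun m => `|(u n x - u m x)%:E|%E)))//.
- apply: le_trans.
    apply: fatou => // m.
    by apply: measurableT_comp => //; apply/measurable_EFinP/measurable_funB.
  under [X in limn_einf X]eq_fun do rewrite -norm_sub.
  rewrite limn_einf_lim; apply: lime_le; first exact: is_cvg_einfs.
  exists n => // m /= nm; apply: ge_ereal_inf.
  exists `|u n - u m|%:E; first by exists m => /=.
  by rewrite lee_fin uC.
- by apply: measurableT_comp => //; apply/measurable_EFinP/measurable_funB.
- apply: measurableT_comp => //.
  apply: measurable_fun_limn_esup => m; apply: measurableT_comp => //.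
  by apply: measurableT_comp => //; apply/measurable_EFinP/measurable_funB.
- apply: filterS ae_cvg => x ux _.
  apply/esym; apply: (cvg_limn_einf_sup _).1.
  apply: cvg_abse; rewrite EFinB.
  by under eq_fun do rewrite EFinB; apply: cvgeB => //; exact: cvg_cst.
Qed.

Let integrable_lim : mu.-integrable [set: T] (EFin \o lim_fun).
Proof.
have int0 : mu.-integrable [set: T] (EFin \o (fun x => u 0%N x - lim_fun x)).
  apply/integrableP; split; first exact/measurable_EFinP/measurable_funB.
  by apply: le_lt_trans (int_lim 0) _; rewrite ltry.
have := integrableB measurableT (L1_integrable (u 0)) int0.
apply: eq_integrable => // x _ /=.
by rewrite -EFinB opprB addrC subrK.
Qed.

Lemma L1_limit : exists f : L1, forall n, `|u n - f| <= 2 * 2^-1 ^+ n.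
Proof.
exists (L1_of integrable_lim) => n.
rewrite -lee_fin; apply: le_trans (int_lim n).
rewrite [leLHS](@eq_L1_norm _ (fun x => u n x - lim_fun x))//.
  exact: measurable_funB.
move: (L1_subE (u n) (L1_of integrable_lim)) (L1_ofE integrable_lim).
by apply: filterS2 => x /(_ I) /= -> /(_ I) /= ->.
Qed.

End limit.

Lemma L1_cauchy_cvg (F : set_system L1) : ProperFilter F -> cauchy F -> cvg F.
Proof.
move=> PF /cauchyP cF.
have /choice[u uF] n : exists f : L1, F (ball f (2^-1 ^+ n)).
  by apply: cF; rewrite exprn_gt0.
have uC n m : (n <= m)%N -> `|u n - u m| <= 2 * 2^-1 ^+ n.
  move=> nm; have [f [fn fm]] := filter_ex (filterI (uF n) (uF m)).
  move: fn fm; rewrite -!ball_normE/= => fn fm.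
  rewrite -(subrKA f) (le_trans (ler_normD _ _))// mulrDl mul1r.
  rewrite lerD ?ltW// distrC (lt_le_trans fm)// .
  by rewrite ler_wiXn2l// invf_le1 ?ler1n.
have [f uf] := L1_limit uC.
apply/cvg_ex; exists f; apply/cvgrPdist_lt => e e0.
have [n ne] : exists n, 3 * 2^-1 ^+ n < e.
  have : `|2^-1 : R| < 1 by rewrite ger0_norm// invf_lt1// ltr1n.
  move=> /(cvg_geometric 3)/cvgrPdist_lt/(_ _ e0)[n _ /(_ n (leqnn n))] /=.
  by rewrite sub0r normrN ger0_norm ?mulr_ge0// => ?; exists n.
apply: filterS (uF n) => g; rewrite -ball_normE/= => ug.
rewrite -(subrKA (u n)) (le_lt_trans (ler_normD _ _))//.
rewrite (le_lt_trans _ ne)// -[3]/(2 + 1)%:R natrD mulrDl mul1r.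
by rewrite lerD ?(ltW ug)// distrC.
Qed.
HB.instance Definition _ := Uniform_isComplete.Build L1 L1_cauchy_cvg.

End L1_space.

Section ell1_space.
Variable R : realType.

Definition absolutely_summable : {pred (nat -> R)} :=
  fun x => `[< cvgn (series (fun n => `|x n|)) >].

Record ell1 := Ell1 {
  ell1_seq :> nat -> R ;
  ell1P : ell1_seq \in absolutely_summable }.

HB.instance Definition _ := [isSub for ell1_seq].
HB.instance Definition _ := [Choice of ell1 by <:].

Lemma absolutely_summable_submod_closed : submod_closed absolutely_summable.
Proof.
split=> [|a x y /asboolP cx /asboolP cy]; apply/asboolP.
  rewrite (_ : series _ = cst 0); first exact: is_cvg_cst.
  by apply/funext => n; rewrite /series/= big1// => i _; rewrite normr0.
apply: (@series_le_cvg _ _ (fun n => `|a| * `|x n| + `|y n|)) => [n|n|n|].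
- exact: normr_ge0.
- by rewrite addr_ge0// mulr_ge0.
- by rewrite (le_trans (ler_normD _ _))// normrM.
- exact/is_cvg_seriesD/cy/is_cvg_seriesZ.
Qed.

HB.instance Definition _ := GRing.isSubmodClosed.Build R (nat -> R)
  absolutely_summable absolutely_summable_submod_closed.
HB.instance Definition _ := [SubChoice_isSubLmodule of ell1 by <:].

Definition ell1_norm (x : ell1) : R := limn (series (fun n => `|x n|)).

Let cvg_ell1 (x : ell1) : cvgn (series (fun n => `|x n|)).
Proof. exact/asboolP/ell1P. Qed.

Let normD (x y : ell1) : ell1_norm (x + y) <= ell1_norm x + ell1_norm y.
Proof.
have cxy := is_cvg_seriesD (@cvg_ell1 x) (@cvg_ell1 y).
rewrite /ell1_norm -(lim_seriesD (@cvg_ell1 x) (@cvg_ell1 y)).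
by apply: (lim_series_le (@cvg_ell1 (x + y)) cxy) => n; exact: ler_normD.
Qed.

Let normZ a (x : ell1) : ell1_norm (a *: x) = `|a| * ell1_norm x.
Proof.
apply: etrans (lim_seriesZ `|a| (@cvg_ell1 x)).
by congr (limn (series _)); apply/funext => n /=; exact: normrM.
Qed.

Let norm0_eq0 (x : ell1) : ell1_norm x = 0 -> x = 0.
Proof.
move=> x0; apply/val_inj/funext => n /=; apply/eqP; rewrite -normr_le0.
have nd : nondecreasing_seq (series (fun n => `|x n|)).
  by apply/nondecreasing_series => k _ _; exact: normr_ge0.
have := nondecreasing_cvgn_le nd (@cvg_ell1 x) n.+1.
rewrite -[limn _]/(ell1_norm x) x0; apply: le_trans.
by rewrite /series/= big_nat_recr//= lerDr sumr_ge0.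
Qed.

HB.instance Definition _ := Lmodule_isNormed.Build R ell1 normD normZ norm0_eq0.

End ell1_space.

Section banach_space_properties.
Context {R : realType}.

Definition bounded_operator (V W : normedModType R) (f : V -> W) :=
  exists M : R, forall x, `|f x| <= M * `|x|.

Context (X : completeNormedModType R).

(* relatively compact means compact closure: see [precompactE] *)
Definition coarse_1_limited (A : set X) :=
  forall S : {linear X -> ell1 R}, bounded_operator S -> precompact (S @` A).

Definition coarse_1_gelfand_phillips :=
  forall A : set X, coarse_1_limited A -> precompact A.

Definition weakly_null (u : nat -> X) :=
  forall phi : {linear X -> R^o}, bounded_operator phi ->
    phi (u n) @[n --> \oo] --> (0 : R^o).

Definition schur_property :=
  forall u : nat -> X, weakly_null u -> u n @[n --> \oo] --> (0 : X).

End banach_space_properties.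

(* Main.v *)
Require Import Defs.
From HB Require Import structures.
From mathcomp Require Import all_boot all_order all_algebra.
From mathcomp Require Import all_classical all_reals all_analysis.
From mathcomp Require Import measurable_realfun ring lra.

Set Implicit Arguments.
Unset Strict Implicit.
Unset Printing Implicit Defensive.

Import Order.TTheory GRing.Theory Num.Theory.
Import numFieldNormedType.Exports.

Local Open Scope classical_set_scope.
Local Open Scope ring_scope.

(** The implication from the coarse 1-Gelfand-Phillips property to the Schur
    property rests on the Schur property of [ell1] ([ell1_schur], a gliding hump
    argument): a bounded operator into [ell1] maps a weakly null sequence to a
    norm null one, so the range of a weakly null sequence is coarse 1-limited and
    therefore relatively compact, and a relatively compact weakly null sequence
    is norm null ([gelfand_phillips_schur]).

    For the converse, the Schur property makes the measure purely atomic on every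
    set of finite measure.  Indeed, on an atomless set [B] of finite positive
    measure one can cut repeatedly into pieces of comparable measure
    ([atomless_split]) and obtain functions that are orthogonal, bounded by one
    and of [L1] norm bounded below ([rademacher_orthogonal],
    [rademacher_norm_ge]); by Bessel's inequality they form a weakly null
    sequence ([rademacher_weakly_null]), which is not norm null.  Now a set that
    is not relatively compact in a complete space contains a sequence whose terms
    are uniformly apart ([precompact_of_seq]).  Countably many integrable
    functions live on a countable union of sets of finite measure, hence on
    countably many disjoint atoms ([schur_atomic_sequence]), and the operator
    mapping [f] to its integrals over these atoms preserves their mutual
    distances ([L1_pieces_isometry]).  So this operator into [ell1] maps the set
    to one that is not relatively compact. *)

(** * Precompact sets and sequences *)

Section precompact_sequences.
Context {R : realType}.

Lemma precompact_cluster_seq (X : normedModType R) (A : set X) (x : nat -> X) :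
  precompact A -> (forall n, A (x n)) ->
  exists y, forall e : R, 0 < e ->
    forall N, exists2 n, (N <= n)%N & `|y - x n| < e.
Proof.
rewrite precompactE => cA Ax.
have [|y [_ xy]] := cA (x @ \oo) _.
  by exists 0%N => // n _; exact/subset_closure/Ax.
exists y => e e0 N.
have [|_ [[n Nn <-] +]] := xy (x @` [set n | (N <= n)%N]) (ball y e) _ (nbhsx_ballx y _ e0).
  by exists N => // n Nn; exists n.
by rewrite -ball_normE; exists n.
Qed.

(** A set without a finite [e]-net contains a sequence whose terms are
    pairwise [e]-apart, chosen greedily; [prefix n] is the list of the first
    [n] choices.  Hence the hypothesis gives total boundedness, and then every
    ultrafilter on the closure is Cauchy, so it converges by completeness. *)
Lemma precompact_of_seq (X : completeNormedModType R) (A : set X) :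
  (forall x : nat -> X, (forall n, A (x n)) -> forall e : R, 0 < e ->
    exists n m, (n < m)%N /\ `|x n - x m| < e) ->
  precompact A.
Proof.
move=> Aseq.
have net e : 0 < e -> exists s : seq X, A `<=` [set x | exists2 y, y \in s & `|y - x| < e].
  move=> e0; apply: contrapT => /forallNP noS.
  have /choice[f fP] (s : seq X) :
      exists x, A x /\ forall y, y \in s -> ~ `|y - x| < e.
    have /existsNP[x /not_implyP[Ax Nx]] := noS s.
    by exists x; split => // y ys yx; apply: Nx; exists y.
  pose prefix n := iter n (fun s => f s :: s) [::].
  have inP n m : (n < m)%N -> f (prefix n) \in prefix m.
    elim: m => // m IH; rewrite ltnS leq_eqVlt => /predU1P[->|/IH nm].
      by rewrite /= mem_head.
    by rewrite /= in_cons nm orbT.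
  have [n [m [nm]]] := Aseq (f \o prefix) (fun n => (fP _).1) e e0.
  exact: (fP (prefix m)).2 (inP _ _ nm).
rewrite precompactE compact_ultra => F FU FA.
have ball_in e : 0 < e -> exists y : X, F (ball y e).
  move=> e0; have e20 : 0 < e / 2 by rewrite divr_gt0.
  have [s As] := net _ e20.
  have : F [set x | exists2 y, y \in s & `|y - x| < e].
    apply: filterS FA => x /(_ _ (nbhsx_ballx x _ e20))[z [/As[y ys yz]]].
    rewrite -ball_normE/= => xz; exists y => //.
    rewrite -(subrKA z) (le_lt_trans (ler_normD _ _))// [ltRHS]splitr ltrD//.
    by rewrite distrC.
  elim: s {As} => [|y s IH].
    by move=> F0; exfalso; apply: (@filter_not_empty _ F); apply: filterS F0 => x [].
  move=> Fs; have [Fy|FNy] := in_ultra_setVsetC (ball y e) FU; first by exists y.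
  apply: IH; apply: filterS2 Fs FNy => x [z].
  rewrite in_cons => /predU1P[-> zx /(_ _)|zs zx _]; last by exists z.
  by rewrite -ball_normE => /(_ zx).
have /cauchy_cvg Fcvg : cauchy F by apply/cauchyP => e; exact: ball_in.
exists (lim F); split => //.
by apply: (@closed_cvg _ _ F _ id) => //; exact: closed_closure.
Qed.

(** A filter on the range together with the limit either clusters at the limit or
    contains a finite set of terms. *)
Lemma precompact_range_cvg (X : normedModType R) (v : nat -> X) (l : X) :
  v n @[n --> \oo] --> l -> precompact (range v).
Proof.
move=> vl; apply: (@precompact_subset _ _ (l |` range v)).
  exact: subsetUr.
apply: compact_precompact; first exact: norm_hausdorff.
move=> F PF FA; have [Fl|] := pselect (cluster F l).
  by exists l; split => //; left.
move=> /existsNP[B /existsNP[U /not_implyP[FB /not_implyP[lU BU]]]].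
have [N _ NU] := vl _ lU.
have cC : compact (v @` [set n | (n < N)%N]).
  apply: finite_compact; apply: finite_image; exact: finite_II.
have [|y [[n _ <-] Fy]] := cC F _.
  apply: filterS2 FA FB => x [->|[n _ <-]] Bx.
    by exfalso; apply: BU; exists l; split => //; exact: nbhs_singleton.
  exists n => //=; rewrite ltnNge; apply/negP => Nn.
  by apply: BU; exists (v n); split => //; exact: NU.
by exists (v n); split => //; right; exists n.
Qed.

End precompact_sequences.

(** * The Schur property of the space of summable sequences *)

Section ell1_schur.
Context {R : realType}.
Implicit Types x : ell1 R.

Lemma cvg_ell1_norm x : series (fun n => `|x n|) n @[n --> \oo] --> `|x|.
Proof. exact/asboolP/ell1P. Qed.

Lemma ell1_partial_le x n : \sum_(0 <= k < n) `|x k| <= `|x|.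
Proof.
have nd : nondecreasing_seq (series (fun n => `|x n|)).
  by apply/nondecreasing_series => k _ _; exact: normr_ge0.
have := nondecreasing_cvgn_le nd (cvgP _ (@cvg_ell1_norm x)) n.
by rewrite (cvg_lim _ (@cvg_ell1_norm x)).
Qed.

Lemma ell1_coord_le x k : `|x k| <= `|x|.
Proof.
apply: le_trans (ell1_partial_le x k.+1).
by rewrite big_nat_recr//= lerDr sumr_ge0.
Qed.

Lemma ell1_coord_is_linear k : linear (fun x : ell1 R => x k : R^o).
Proof. by move=> a x y. Qed.

Definition ell1_coord k : {linear ell1 R -> R^o} :=
  HB.pack (fun x : ell1 R => x k : R^o)
    (GRing.isLinear.Build _ _ _ _ _ (ell1_coord_is_linear k)).

Lemma ell1_coord_bounded k : bounded_operator (ell1_coord k).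
Proof. by exists 1 => x; rewrite mul1r; exact: ell1_coord_le. Qed.

Section pairing.
Variable b : nat -> R.
Hypothesis b1 : forall k, `|b k| <= 1.

Let bx x n : R := b n * x n.

Let le_bx x n : `|bx x n| <= `|x n|.
Proof. by rewrite /bx normrM ler_piMl. Qed.

Lemma is_cvg_ell1_pairing_norm x : cvgn [normed series (bx x)].
Proof.
apply: (@series_le_cvg _ _ (fun n => `|x n|)) => [n|n|n|].
- exact: normr_ge0.
- exact: normr_ge0.
- exact: le_bx.
- exact: cvgP (@cvg_ell1_norm x).
Qed.

Lemma is_cvg_ell1_pairing x : cvgn (series (bx x)).
Proof. exact: (@normed_cvg R R^o) (@is_cvg_ell1_pairing_norm x). Qed.

Lemma ell1_pairing_is_linear :
  linear (fun x : ell1 R => limn (series (bx x)) : R^o).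
Proof.
move=> a x y; have cx := @is_cvg_ell1_pairing x.
have cy := @is_cvg_ell1_pairing y.
rewrite -(lim_seriesZ a cx) -(lim_seriesD (is_cvg_seriesZ (k:=a) cx) cy).
congr (limn (series _)); apply/funext => n.
by rewrite /bx/= mulrDr mulrCA.
Qed.

Definition ell1_pairing : {linear ell1 R -> R^o} :=
  HB.pack (fun x : ell1 R => limn (series (bx x)) : R^o)
    (GRing.isLinear.Build _ _ _ _ _ ell1_pairing_is_linear).

Lemma ell1_pairing_bounded : bounded_operator ell1_pairing.
Proof.
exists 1 => x; rewrite mul1r.
have c := @is_cvg_ell1_pairing_norm x.
apply: le_trans (lim_series_norm c) _.
rewrite -(cvg_lim _ (@cvg_ell1_norm x))//.
apply: lim_series_le => //; first exact: cvgP (@cvg_ell1_norm x).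
by move=> n; exact: le_bx.
Qed.

(** On the block from [K] to [L] the sequence [b] aligns with the signs of [x];
    outside it the pairing loses at most the mass of [x] there. *)
Lemma ell1_pairing_ge x (K L : nat) : (K <= L)%N ->
  (forall k, (K <= k < L)%N -> b k * x k = `|x k|) ->
  2 * (\sum_(0 <= k < L) `|x k|) - 2 * (\sum_(0 <= k < K) `|x k|) - `|x|
    <= ell1_pairing x.
Proof.
move=> KL bxE; apply: limr_ge; first exact: is_cvg_ell1_pairing.
near=> N; have LN : (L <= N)%N by near: N; exists L.
have big m n : - (\sum_(m <= k < n) `|x k|) <= \sum_(m <= k < n) bx x k.
  rewrite -sumrN; apply: ler_sum => k _; rewrite lerNl.
  by rewrite (le_trans (ler_norm _))// normrN.
have := ell1_partial_le x N; have := big 0%N K; have := big L N.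
have split (f : nat -> R) : \sum_(0 <= k < N) f k = \sum_(0 <= k < K) f k +
    \sum_(K <= k < L) f k + \sum_(L <= k < N) f k.
  by rewrite -!big_cat_nat.
have -> : \sum_(0 <= k < L) `|x k| =
    \sum_(0 <= k < K) `|x k| + \sum_(K <= k < L) `|x k|.
  by rewrite -big_cat_nat.
rewrite /series/= !split.
have -> : \sum_(K <= k < L) bx x k = \sum_(K <= k < L) `|x k|.
  by apply: eq_big_nat => k; exact: bxE.
lra.
Unshelve. all: by end_near. Qed.

End pairing.

(** Gliding hump.  A weakly null sequence tends to zero in each coordinate, so if
    its norms exceed [e] infinitely often one can select terms, each carrying
    all but a quarter of [e] of its norm on a block of coordinates, with these
    blocks consecutive.  The bounded sequence [b] that follows the signs
    of each selected term on its block pairs to at least [e / 2] with each of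
    them, against weak nullity. *)
Lemma ell1_schur (v : nat -> ell1 R) :
  (forall phi : {linear ell1 R -> R^o}, bounded_operator phi ->
    phi (v n) @[n --> \oo] --> (0 : R^o)) ->
  v n @[n --> \oo] --> (0 : ell1 R).
Proof.
move=> wv; apply: contrapT => nv.
have [e e0 ev] : exists2 e : R, 0 < e &
    forall N, exists2 n, (N <= n)%N & e <= `|v n|.
  apply: contrapT => ne; apply: nv; apply/cvgrPdist_lt => e e0.
  apply: contrapT => nev; apply: ne; exists e => // N.
  apply: contrapT => nN; apply: nev; exists N => // n /= Nn.
  by rewrite sub0r normrN ltNge; apply/negP => en; apply: nN; exists n.
have head K : (\sum_(0 <= k < K) `|v n k|) @[n --> \oo] --> (0 : R).
  elim: K => [|K IH].
    by under eq_fun do rewrite big_nil; exact: cvg_cst.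
  under eq_fun do rewrite big_nat_recr//=.
  have vK : `|v n K| @[n --> \oo] --> (0 : R).
    by apply/norm_cvg0P; exact: wv (ell1_coord_bounded K).
  by have := cvgD IH vK; rewrite addr0; exact.
(* [p K] is a pair of an index [n >= K] and an end of block [L > K]: the mass
   of [v n] before [K] and the mass after [L] are both below [e / 8]. *)
have e80 : 0 < e / 8 by rewrite divr_gt0.
have /choice[p pP] K : exists q : nat * nat, [/\ (K <= q.1)%N, (K < q.2)%N,
    e <= `|v q.1|, \sum_(0 <= k < K) `|v q.1 k| < e / 8 &
    `|v q.1| - \sum_(0 <= k < q.2) `|v q.1 k| < e / 8].
  have /cvgrPdist_lt/(_ _ e80)[N _ NK] := head K.
  have [n] := ev (maxn N K); rewrite geq_max => /andP[Nn Kn] en.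
  have /cvgrPdist_lt/(_ _ e80)[L _ LL] := @cvg_ell1_norm (v n).
  exists (n, maxn K.+1 L); split => //=.
  - by rewrite leq_max leqnn.
  - by have /= := NK n Nn; rewrite sub0r normrN ger0_norm// sumr_ge0.
  - by apply: le_lt_trans (ler_norm _) _; apply: LL; exact: leq_maxr.
pose K j := iter j (fun k => (p k).2) 0%N.
have KS j : (K j < K j.+1)%N by have [] := pP (K j).
have Khomo : {homo K : i j / (i <= j)%N}.
  by apply: homo_leq => // [? ? ?|j]; [exact: leq_trans|exact: ltnW].
have Kj j : (j <= K j)%N by elim: j => // j IH; exact: leq_ltn_trans IH (KS j).
(* The blocks are disjoint, so each coordinate has to match the sign of at most
   one of the selected terms. *)
have /choice[b bP] k : exists c : R, `|c| <= 1 /\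
    forall j, (K j <= k < K j.+1)%N -> c * v (p (K j)).1 k = `|v (p (K j)).1 k|.
  have [[j /andP[jk kj]]|nj] := pselect (exists j, (K j <= k < K j.+1)%N).
    exists (Num.sg (v (p (K j)).1 k)); split.
      by rewrite normr_sg lern1 leq_b1.
    move=> i /andP[ik ki]; suff -> : i = j by rewrite -normrEsg.
    have lt a c : (K a <= k)%N -> (k < K c.+1)%N -> (a <= c)%N.
      move=> ak kc; rewrite leqNgt; apply/negP => /Khomo ca.
      by have := leq_ltn_trans (leq_trans ca ak) kc; rewrite ltnn.
    by apply/eqP; rewrite eqn_leq (lt _ _ ik kj) (lt _ _ jk ki).
  by exists 0; rewrite normr0; split => // j jk; exfalso; apply: nj; exists j.
have b1 k := (bP k).1.
have /cvgrPdist_lt/(_ (e / 2)) := wv _ (ell1_pairing_bounded b1).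
case; first by rewrite divr_gt0.
move=> N _ /(_ (p (K N)).1) /=.
have [Kn _ en hd tl] := pP (K N).
move=> /(_ (leq_trans (Kj N) Kn)); rewrite sub0r normrN.
have /(_ b1) := @ell1_pairing_ge b _ (v (p (K N)).1) (K N) (K N.+1) (ltnW (KS N)).
move=> /(_ (fun k => (bP k).2 N)) lb ub.
have := le_lt_trans (ler_norm _) ub.
move: lb hd tl en e0; rewrite /K/=; lra.
Qed.

End ell1_schur.

(** * Atoms and exhaustion in sets of finite measure *)

Section finite_piece.
Context d (T : measurableType d) (R : realType).
Variable mu : {measure set T -> \bar R}.

(** Atoms and null sets together: unlike genuine atoms, this class is closed under
    measurable subsets, which lets a sequence of such sets be made disjoint. *)
Definition almost_atom (A : set T) := measurable A /\
  forall F, measurable F -> F `<=` A -> mu F = 0 \/ mu (A `\` F) = 0.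

Definition atomically_covered (E : set T) := exists a : nat -> set T,
  (forall i, almost_atom (a i)) /\ mu.-negligible (E `\` \bigcup_i a i).

Lemma almost_atomS A B : measurable B -> B `<=` A ->
  almost_atom A -> almost_atom B.
Proof.
move=> mB BA [mA atA]; split => // F mF FB.
have [|AF0] := atA F mF (subset_trans FB BA); first by left.
right; apply: subset_measure0 AF0; [exact: measurableD|exact: measurableD|].
exact: setSD.
Qed.

Lemma almost_atom0 : almost_atom set0.
Proof.
by split => // F _; rewrite subset0 => ->; left; rewrite measure0.
Qed.

Lemma atomically_covered_atom A : almost_atom A -> atomically_covered A.
Proof.
move=> atA; exists (fun=> A); split => //.
by rewrite bigcup_const ?setDv; [exact: negligible_set0|exists 0%N].
Qed.

Lemma atomically_covered_bigcup (E : nat -> set T) :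
  (forall n, atomically_covered (E n)) ->
  atomically_covered (\bigcup_n E n).
Proof.
move=> /choice[a aP].
exists (fun k => if unpickle k is Some ni then a ni.1 ni.2 else set0); split.
  move=> k; case: unpickle => [[n i]|]; first exact: (aP n).1.
  exact: almost_atom0.
apply: (@negligibleS _ _ _ _ (\bigcup_n (E n `\` \bigcup_i a n i))).
  move=> x [[n _ Ex] ax]; exists n => //; split => // -[i _ aix].
  by apply: ax; exists (pickle (n, i)) => //; rewrite pickleK.
by apply: negligible_bigcup => n; exact: (aP n).2.
Qed.

Variable B : set T.
Hypotheses (mB : measurable B) (fB : (mu B < +oo)%E).

Definition msize (E : set T) : R := fine (mu E).

Lemma msizeE E : measurable E -> E `<=` B -> mu E = (msize E)%:E.
Proof.
move=> mE EB; rewrite /msize fineK// ge0_fin_numE//.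
by apply: le_lt_trans fB; apply: le_measure => //; rewrite inE.
Qed.

Lemma msize_ge0 E : 0 <= msize E.
Proof. exact: fine_ge0. Qed.

Lemma msizeU E F : measurable E -> measurable F -> E `<=` B -> F `<=` B ->
  E `&` F = set0 -> msize (E `|` F) = msize E + msize F.
Proof.
move=> mE mF EB FB EF; apply: EFin_inj; rewrite EFinD -!msizeE ?measureU//.
- exact: measurableU.
- by rewrite subUset.
Qed.

Lemma msizeD E F : measurable E -> measurable F -> E `<=` B -> F `<=` E ->
  msize (E `\` F) = msize E - msize F.
Proof.
move=> mE mF EB FE; have mD : measurable (E `\` F) by exact: measurableD.
have /(_ (subset_trans FE EB)) := msizeU mF mD.
rewrite setDIK setDUK// => ->//; first by rewrite addrAC subrr add0r.
by apply: subset_trans EB; exact: subDsetl.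
Qed.

Lemma le_msize E F : measurable E -> measurable F -> E `<=` F -> F `<=` B ->
  msize E <= msize F.
Proof.
move=> mE mF EF FB; rewrite -subr_ge0 -msizeD//; exact: msize_ge0.
Qed.

(** [P] is the union of a sequence in [C] whose measures tend to their supremum
    over [C]; its union with a member of [C] adding mass would exceed that. *)
Lemma exhaustion (C : set (set T)) :
  (forall E, C E -> measurable E /\ E `<=` B) -> C set0 ->
  (forall E : nat -> set T, (forall n, C (E n)) -> C (\bigcup_n E n)) ->
  exists2 P, C P & forall Q, C Q -> mu (Q `\` P) = 0.
Proof.
move=> CB C0 CU; pose S := msize @` C.
have supS : has_sup S.
  split; first by exists (msize set0); exists set0.
  by exists (msize B) => _ [E /CB[mE EB] <-]; exact: le_msize.
have /choice[P PP] n : exists E, C E /\ sup S - n.+1%:R^-1 < msize E.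
  have [|_ [E CE <-] ?] := @sup_adherent _ S n.+1%:R^-1 _ supS.
    by rewrite invr_gt0.
  by exists E.
have CP := CU P (fun n => (PP n).1); exists (\bigcup_n P n) => // Q CQ.
set P' := \bigcup_n P n in CP *.
have [mP PB] := CB _ CP; have [mQ QB] := CB _ CQ.
have supP : sup S <= msize P'.
  apply/ler_addgt0Pr => e e0.
  have [n] := ltr_add_invr e0; rewrite add0r => ne.
  rewrite -lerBlDr; apply: le_trans (le_trans (ltW (PP n).2) _).
    by rewrite lerB// ltW.
  have [mPn _] := CB _ (PP n).1; apply: le_msize => //.
  exact: bigcup_sup.
have CPQ : C (P' `|` Q).
  rewrite (_ : P' `|` Q = \bigcup_n (if n == 0%N then P' else Q)).
    by apply: CU => n; case: ifP.
  apply/seteqP; split => [x [Px|Qx]|x [n _]].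
  - by exists 0%N.
  - by exists 1%N.
  - by case: ifP => _; [left|right].
have : msize (P' `|` Q) <= sup S by apply: ub_le_sup; [exact: supS.2|exists (P' `|` Q)].
have [mQP QPB] : measurable (Q `\` P') /\ Q `\` P' `<=` B.
  by split; [exact: measurableD|apply: subset_trans QB; exact: subDsetl].
rewrite (_ : P' `|` Q = P' `|` (Q `\` P')); last by rewrite setUDr setDv setD0.
rewrite msizeU ?setDIK// => le; rewrite msizeE//; congr EFin.
apply/eqP; rewrite eq_le msize_ge0 andbT; lra.
Qed.

(** Equivalently, every non-null measurable subset of [B] splits into two non-null
    measurable pieces. *)
Definition atomless := forall A, almost_atom A -> A `<=` B -> mu A = 0.

(** A weak form of the theorem of Sierpinski, enough for the Rademacher functions
    below.  If no subset of [E] had a measure between a third and two thirds of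
    that of [E], then the union of two subsets below one third would again be
    below one third, so these small subsets are closed under countable unions
    and there is a largest one, [P].  Every non-null subset of its complement
    exceeds two thirds of [E], so the complement cannot be cut into two non-null
    pieces: it is an almost atom. *)
Lemma atomless_split : atomless -> forall E, measurable E -> E `<=` B ->
  exists F, [/\ measurable F, F `<=` E, msize E <= 3 * msize F &
    3 * msize F <= 2 * msize E].
Proof.
move=> atB E mE EB; apply: contrapT => /forallNP noF.
have dich F : measurable F -> F `<=` E ->
    3 * msize F < msize E \/ 2 * msize E < 3 * msize F.
  move=> mF FE; have [?|EF] := ltP (3 * msize F) (msize E); first by left.
  have [?|FE2] := ltP (2 * msize E) (3 * msize F); first by right.
  by exfalso; exact: (noF F).
have E0 : 0 < msize E.
  have := msize_ge0 E; have := dich set0 measurable0 (@sub0set _ _).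
  by rewrite /msize measure0/=; case; lra.
pose C F := [/\ measurable F, F `<=` E & 3 * msize F < msize E].
have CU F G : C F -> C G -> C (F `|` G).
  move=> [mF FE lF] [mG GE lG].
  have mFG : measurable (F `|` G) by exact: measurableU.
  have FGE : F `|` G `<=` E by rewrite subUset.
  split => //; have [//|] := dich (F `|` G) mFG FGE.
  rewrite (_ : F `|` G = F `|` (G `\` F)); last by rewrite setUDr setDv setD0.
  rewrite msizeU ?setDIK//.
  - have : msize (G `\` F) <= msize G.
      apply: (le_msize (measurableD mG mF) mG (@subDsetl _ _ _)).
      exact: subset_trans EB.
    by lra.
  - exact: measurableD.
  - exact: subset_trans EB.
  - by apply: subset_trans EB; apply: subset_trans GE; exact: subDsetl.
have C0 : C set0.
  by split => //; rewrite /msize measure0 mulr0.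
have CUn (F : nat -> set T) n : (forall k, C (F k)) -> C (\big[setU/set0]_(k < n) F k).
  by move=> CF; elim/big_ind : _.
have CUoo (F : nat -> set T) : (forall k, C (F k)) -> C (\bigcup_n F n).
  move=> CF; have mF k := let: And3 m _ _ := CF k in m.
  have mU : measurable (\bigcup_n F n) by exact: bigcup_measurable.
  have UE : \bigcup_n F n `<=` E by apply: bigcup_sub => k _; have [] := CF k.
  split => //; have [//|] := dich _ mU UE.
  suff : msize (\bigcup_n F n) <= msize E / 3 by lra.
  rewrite -lee_fin -msizeE//; last exact: subset_trans EB.
  have mUn n : measurable (\big[setU/set0]_(k < n) F k).
    by have [] := CUn F n CF.
  have cvg : (mu \o (fun n => \big[setU/set0]_(k < n.+1) F k)) n @[n --> \oo] -->
      mu (\bigcup_n F n).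
    rewrite -bigcup_bigsetU_bigcup; apply: nondecreasing_cvg_mu => //.
      by rewrite bigcup_bigsetU_bigcup.
    by move=> n m nm; apply/subsetPset/subset_bigsetU.
  rewrite -(cvg_lim _ cvg)//; apply: lime_le; first exact: cvgP cvg.
  near=> n; have [mFn FnE lFn] := CUn F n.+1 CF.
  rewrite /= msizeE//; last exact: subset_trans EB.
  by rewrite lee_fin; lra.
have [|P [mP PE lP] Pmax] := @exhaustion C _ C0 CUoo.
  by move=> F [mF FE _]; split => //; exact: subset_trans EB.
have PB : P `<=` B by exact: subset_trans EB.
have mQ : measurable (E `\` P) by exact: measurableD.
have QB : E `\` P `<=` B by apply: subset_trans EB; exact: subDsetl.
have sQ := msizeD mE mP EB PE.
have big F : measurable F -> F `<=` E `\` P -> mu F <> 0 ->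
    2 * msize E < 3 * msize F.
  move=> mF FQ F0; have FE : F `<=` E by apply: subset_trans FQ _; exact: subDsetl.
  have [lF|//] := dich F mF FE; exfalso; apply: F0.
  have := Pmax F (And3 mF FE lF); rewrite setDidl//.
  by apply/disjoints_subset => x /FQ[].
have : ~ almost_atom (E `\` P).
  move=> /atB/(_ QB); rewrite msizeE// sQ => -[]; lra.
move=> /not_andP[//|/existsNP[F /not_implyP[mF /not_implyP[FQ /not_orP[F0 QF0]]]]].
have mQF : measurable ((E `\` P) `\` F) by exact: measurableD.
have := big F mF FQ F0.
have := big _ mQF (@subDsetl _ _ _) QF0.
rewrite (msizeD mQ mF QB FQ) sQ.
have := msize_ge0 P; lra.
Unshelve. all: by end_near. Qed.

End finite_piece.

(** * Operators on the space of integrable functions *)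

Section L1_operators.
Context d (T : measurableType d) (R : realType).
Variable mu : {measure set T -> \bar R}.
Local Notation L1 := (LspaceType1 mu).

Lemma L1_integrableS (f : L1) E : measurable E ->
  mu.-integrable E (EFin \o f).
Proof. by move=> mE; apply: integrableS (L1_integrable f). Qed.

Lemma eq_ae_Rintegral (f g : T -> R) E : measurable E ->
  measurable_fun [set: T] f -> measurable_fun [set: T] g ->
  f = g %[ae mu in E] -> \int[mu]_(x in E) f x = \int[mu]_(x in E) g x.
Proof.
move=> mE mf mg fg; congr fine; apply: ae_eq_integral => //.
- exact/measurable_EFinP/measurable_funTS.
- exact/measurable_EFinP/measurable_funTS.
- by apply: filterS fg => x /[apply] ->.
Qed.

Lemma L1_norm_Rintegral (f : L1) : `|f| = \int[mu]_x `|f x|.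
Proof. by rewrite /Rintegral/= -[RHS]/(fine (\int[mu]_x `|(f x)%:E|)%E) -L1_norm_int. Qed.

Lemma L1_norm_eq (f : L1) (g : T -> R) : measurable_fun [set: T] g ->
  (f : T -> R) = g %[ae mu] -> `|f| = \int[mu]_x `|g x|.
Proof.
move=> mg fg; rewrite L1_norm_Rintegral; apply: eq_ae_Rintegral => //.
- by apply: measurableT_comp => //; exact: measurable_L1.
- exact: measurableT_comp.
- by apply: filterS fg => x /[apply] ->.
Qed.

Lemma L1_integrable_norm (f : L1) E : measurable E ->
  mu.-integrable E (EFin \o (fun x => `|f x|)).
Proof. by move=> mE; exact: integrable_norm (L1_integrableS f mE). Qed.

Lemma L1_set_norm_le (f : L1) E : measurable E ->
  \int[mu]_(x in E) `|f x| <= `|f|.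
Proof.
move=> mE; rewrite L1_norm_Rintegral -(setUv E) Rintegral_setU//.
- by rewrite lerDl Rintegral_ge0.
- exact: measurableC.
- by rewrite setUv; exact: L1_integrable_norm.
- by apply/disj_setPS; rewrite setICr.
Qed.

Section integral_functional.
Variables (E : set T) (mE : measurable E).

Lemma L1_int_is_linear :
  linear (fun f : L1 => \int[mu]_(x in E) f x : R^o).
Proof.
move=> a f g; have mf := measurable_L1 f; have mg := measurable_L1 g.
rewrite -[LHS]/(\int[mu]_(x in E) ((a *: f + g : L1) : T -> R) x).
rewrite -[RHS]/(a * \int[mu]_(x in E) f x + \int[mu]_(x in E) g x).
transitivity (\int[mu]_(x in E) (a * f x + g x)).
  apply: eq_ae_Rintegral => //; first exact: measurable_L1.
    by apply: measurable_funD => //; exact: measurable_funM.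
  apply: (@ae_eq_subset _ _ _ _ mu [set: T]) => //.
  move: (L1_addE (a *: f) g) (L1_scaleE a f).
  by apply: filterS2 => x /(_ I) /= -> /(_ I) /= ->.
have if_ := L1_integrableS f mE; have ig := L1_integrableS g mE.
rewrite RintegralD//; last exact: (integrableZl _ _ if_).
by rewrite RintegralZl.
Qed.

Definition L1_int : {linear L1 -> R^o} :=
  HB.pack (fun f : L1 => \int[mu]_(x in E) f x : R^o)
    (GRing.isLinear.Build _ _ _ _ _ L1_int_is_linear).

Lemma L1_int_bounded : bounded_operator L1_int.
Proof.
exists 1 => f; rewrite mul1r; apply: le_trans (L1_set_norm_le f mE).
by apply: le_normr_Rintegral => //; exact: L1_integrableS.
Qed.

End integral_functional.

Lemma L1_int_eq0 (f : L1) :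
  (forall E, measurable E -> \int[mu]_(x in E) f x = 0) -> f = 0.
Proof.
move=> f0; apply: L1_eq.
have : ae_eq mu [set: T] (EFin \o f) (EFin \o cst 0).
  apply: (integral_ae_eq measurableT (L1_integrable f)).
    exact/measurable_EFinP/measurable_cst.
  move=> E _ mE; rewrite integral0.
  have fin := integrable_fin_num mE (L1_integrableS f mE).
  by rewrite -(fineK fin); congr EFin; exact: f0.
move: (L1_zeroE mu); apply: filterS2 => x /(_ I) /= -> /(_ I).
by case.
Qed.

Section atoms_operator.
Variable a : nat -> set T.
Hypotheses (ma : forall i, measurable (a i)) (ta : trivIset [set: nat] a).

Lemma cvg_integral_pieces (f : L1) :
  series (fun i => \int[mu]_(x in a i) `|f x|) n @[n --> \oo] -->
  \int[mu]_(x in \bigcup_i a i) `|f x|.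
Proof.
have mU : measurable (\bigcup_i a i) by exact: bigcup_measurable.
have fin E (mE : measurable E) := integrable_fin_num mE (L1_integrable_norm f mE).
have intE : (\int[mu]_(x in \bigcup_i a i) (`|f x|)%:E =
    \sum_(0 <= i <oo) \int[mu]_(x in a i) (`|f x|)%:E)%E.
  apply: ge0_integral_bigcup => //; apply: measurable_funTS.
  apply/measurable_EFinP; apply: measurableT_comp => //; exact: measurable_L1.
have : (\sum_(0 <= i < n) \int[mu]_(x in a i) (`|f x|)%:E)%E @[n --> \oo] -->
    (\int[mu]_(x in \bigcup_i a i) `|f x|)%:E.
  rewrite /Rintegral fineK; last exact: fin mU.
  by rewrite intE; apply: is_cvg_nneseries => n _ _; exact: integral_ge0.
move/fine_cvgP => [_].
rewrite (_ : _ \o _ = series (fun i => \int[mu]_(x in a i) `|f x|))//.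
apply/funext => n /=; rewrite /series/= -sum_fine//.
by move=> i _; exact: fin.
Qed.

Lemma L1_pieces_summable (f : L1) :
  (fun i => \int[mu]_(x in a i) f x) \in @absolutely_summable R.
Proof.
apply/asboolP.
apply: (@series_le_cvg _ _ (fun i => \int[mu]_(x in a i) `|f x|)) => [n|n|n|].
- exact: normr_ge0.
- exact: Rintegral_ge0.
- by apply: le_normr_Rintegral => //; exact: L1_integrableS.
- exact: cvgP (@cvg_integral_pieces f).
Qed.

Lemma L1_pieces_is_linear :
  linear (fun f : L1 => Ell1 (L1_pieces_summable f)).
Proof.
move=> c f g; apply/val_inj/funext => i.
exact: (L1_int_is_linear (ma i) c f g).
Qed.

Definition L1_pieces : {linear L1 -> ell1 R} :=
  HB.pack (fun f : L1 => Ell1 (L1_pieces_summable f))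
    (GRing.isLinear.Build _ _ _ _ _ L1_pieces_is_linear).

Lemma L1_pieces_bounded : bounded_operator L1_pieces.
Proof.
exists 1 => f; rewrite mul1r.
have mU : measurable (\bigcup_i a i) by exact: bigcup_measurable.
apply: le_trans (L1_set_norm_le f mU).
rewrite -(cvg_lim _ (@cvg_ell1_norm R (L1_pieces f)))//.
rewrite -(cvg_lim _ (@cvg_integral_pieces f))//.
apply: lim_series_le.
- exact: cvgP (@cvg_ell1_norm R (L1_pieces f)).
- exact: cvgP (@cvg_integral_pieces f).
- by move=> i; apply: le_normr_Rintegral => //; exact: L1_integrableS.
Qed.

(** On an almost atom, one of the sets where [f] is nonnegative or negative is
    null, so [f] has a constant sign almost everywhere. *)
Lemma almost_atom_int (f : L1) A : almost_atom mu A ->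
  `|\int[mu]_(x in A) f x| = \int[mu]_(x in A) `|f x|.
Proof.
move=> [mA atA]; have mf := measurable_L1 f.
have mnf : measurable_fun [set: T] (fun x => `|f x|) by exact: measurableT_comp.
pose F := A `&` f @^-1` `[0, +oo[.
have mF : measurable F.
  by apply: measurableI => //; rewrite -[_ @^-1` _]setTI; exact: mf.
have ae (g h : T -> R) N : measurable N -> mu N = 0 ->
    (forall x, A x -> ~ N x -> g x = h x) -> g = h %[ae mu in A].
  move=> mN N0 gh; exists N; split => // x /=.
  by move=> /not_implyP[Ax ghx]; apply: contrapT => Nx; apply/ghx/gh.
have fA := L1_integrableS f mA.
have nfA := L1_integrable_norm f mA.
have nf0 : 0 <= \int[mu]_(x in A) `|f x| by exact: Rintegral_ge0.
have [F0|F0] := atA F mF (@subIsetl _ _ _).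
  rewrite (_ : Rintegral _ _ _ = \int[mu]_(x in A) (-1 * `|f x|)); last first.
    apply: eq_ae_Rintegral => //; first exact: measurable_funM.
    apply: ae mF F0 _ => x Ax Fx; rewrite mulN1r ler0_norm ?opprK//.
    rewrite leNgt; apply/negP => f0; apply: Fx; split => //=.
    by rewrite in_itv/= andbT ltW.
  by rewrite RintegralZl// normrM normrN1 mul1r ger0_norm.
rewrite (_ : Rintegral _ _ _ = \int[mu]_(x in A) `|f x|) ?ger0_norm//.
apply: eq_ae_Rintegral => //.
apply: (ae _ _ _ (measurableD mA mF) F0) => x Ax Fx.
rewrite ger0_norm// leNgt; apply/negP => f0; apply: Fx; split => // -[_ /=].
by rewrite in_itv/= andbT leNgt f0.
Qed.

(** A function carried by disjoint almost atoms is recovered in norm from its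
    integrals over them. *)
Lemma L1_pieces_isometry (f : L1) : (forall i, almost_atom mu (a i)) ->
  (f : T -> R) = cst 0 %[ae mu in ~` (\bigcup_i a i)] ->
  `|L1_pieces f| = `|f|.
Proof.
move=> ata f0.
have mU : measurable (\bigcup_i a i) by exact: bigcup_measurable.
have mUC := measurableC mU.
rewrite [RHS]L1_norm_Rintegral -(setUv (\bigcup_i a i)) Rintegral_setU//.
- rewrite [X in _ = _ + X](_ : _ = \int[mu]_(x in ~` (\bigcup_i a i)) 0); last first.
    apply: eq_ae_Rintegral => //.
      by apply: measurableT_comp => //; exact: measurable_L1.
    by apply: filterS f0 => x /[apply] ->; rewrite normr0.
  rewrite Rintegral_cst// mul0r addr0.
  rewrite -(cvg_lim _ (@cvg_ell1_norm R (L1_pieces f)))//.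
  rewrite -(cvg_lim _ (@cvg_integral_pieces f))//.
  congr (limn (series _)); apply/funext => i; exact: almost_atom_int.
- by rewrite setUv; exact: L1_integrable_norm.
- by apply/disj_setPS; rewrite setICr.
Qed.

End atoms_operator.

End L1_operators.

(** * Rademacher functions on an atomless set *)

Section rademacher.
Context d (T : measurableType d) (R : realType).
Variable mu : {measure set T -> \bar R}.
Variable B : set T.
Hypotheses (mB : measurable B) (fB : (mu B < +oo)%E).

(** Bounded measurable functions vanishing off [B]: a class stable under products
    and consisting of integrable functions when [B] has finite measure. *)
Definition bounded_on (f : T -> R) := [/\ measurable_fun [set: T] f,
  forall x, ~ B x -> f x = 0 & exists M, forall x, `|f x| <= M].

Lemma bounded_on_integrable f : bounded_on f ->
  mu.-integrable [set: T] (EFin \o f).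
Proof.
move=> [mf f0 [M fM]].
have -> : EFin \o f = (EFin \o f) \_ B.
  apply/funext => x; rewrite patchE/=; case: ifPn => //.
  by rewrite notin_setE => /f0 ->.
apply/(integrable_mkcond _ mB).
apply: measurable_bounded_integrable => //; first exact: measurable_funTS.
exists M; split; first exact: num_real.
by move=> y My x _ /=; exact: le_trans (fM x) (ltW My).
Qed.

Lemma bounded_onD f g : bounded_on f -> bounded_on g -> bounded_on (f \+ g).
Proof.
move=> [mf f0 [M fM]] [mg g0 [N gN]]; split; first exact: measurable_funD.
  by move=> x Bx /=; rewrite f0// g0// addr0.
by exists (M + N) => x; apply: le_trans (ler_normD _ _) (lerD _ _).
Qed.

Lemma bounded_onM f g : bounded_on f -> bounded_on g -> bounded_on (f \* g).
Proof.
move=> [mf f0 [M fM]] [mg g0 [N gN]]; split; first exact: measurable_funM.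
  by move=> x Bx /=; rewrite f0// mul0r.
by exists (M * N) => x /=; rewrite normrM ler_pM.
Qed.

Lemma bounded_onZ a f : bounded_on f -> bounded_on (fun x => a * f x).
Proof.
move=> [mf f0 [M fM]]; split; first exact: measurable_funM.
  by move=> x Bx /=; rewrite f0// mulr0.
by exists (`|a| * M) => x /=; rewrite normrM ler_wpM2l.
Qed.

Lemma bounded_on_abs f : bounded_on f -> bounded_on (fun x => `|f x|).
Proof.
move=> [mf f0 [M fM]]; split; first exact: measurableT_comp.
  by move=> x Bx /=; rewrite f0// normr0.
by exists M => x /=; rewrite normr_id.
Qed.

Lemma bounded_on_indic E : measurable E -> E `<=` B -> bounded_on (\1_E).
Proof.
move=> mE EB; split; first exact: measurable_indic.
  by move=> x Bx; rewrite indicE memNset// => /EB.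
by exists 1 => x; rewrite indicE ger0_norm// lern1 leq_b1.
Qed.

Local Notation Int f := (\int[mu]_x f x).

Lemma integral_bounded_onD f g : bounded_on f -> bounded_on g ->
  Int (fun x => f x + g x) = Int f + Int g.
Proof. by move=> bf bg; rewrite RintegralD//; exact: bounded_on_integrable. Qed.

Lemma integral_bounded_onZ a f : bounded_on f ->
  Int (fun x => a * f x) = a * Int f.
Proof. by move=> bf; rewrite RintegralZl//; exact: bounded_on_integrable. Qed.

Lemma integral_bounded_on_le f g : bounded_on f -> bounded_on g ->
  (forall x, f x <= g x) -> Int f <= Int g.
Proof.
by move=> bf bg fg; apply: le_Rintegral => //; exact: bounded_on_integrable.
Qed.

Lemma integral_bounded_on_indic E : measurable E -> Int (\1_E : T -> R) = msize mu E.
Proof.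
by move=> mE; rewrite /Rintegral integral_indic// setIT.
Qed.

Hypothesis atB : atomless mu B.

Lemma halving_exists : exists half : set T -> set T,
  forall E, measurable E -> E `<=` B ->
    [/\ measurable (half E), half E `<=` E, msize mu E <= 3 * msize mu (half E) &
    3 * msize mu (half E) <= 2 * msize mu E].
Proof.
have /choice[h hP] E : exists F, measurable E -> E `<=` B ->
    [/\ measurable F, F `<=` E, msize mu E <= 3 * msize mu F &
    3 * msize mu F <= 2 * msize mu E].
  have [[mE EB]|nE] := pselect (measurable E /\ E `<=` B).
    by have [F] := atomless_split mB fB atB mE EB; exists F.
  by exists set0 => mE EB; exfalso; exact: nE.
by exists h.
Qed.

Definition half := sval (cid halving_exists).

Lemma halfP E : measurable E -> E `<=` B ->
  [/\ measurable (half E), half E `<=` E, msize mu E <= 3 * msize mu (half E) &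
  3 * msize mu (half E) <= 2 * msize mu E].
Proof. by rewrite /half; case: cid => h /= /[apply]. Qed.

Local Notation rest E := (E `\` half E).

(** The [n]-th function of a system on [E] in which halves are only approximate:
    on a cell [F] of the [n]-th generation of cuts, it takes one value on
    [half F] and another on the rest of [F], weighted so that its mean over [F]
    is zero.  Recursion on both pieces at once makes every property of the
    system an induction on [n] over all [E]. *)
Fixpoint rademacher n (E : set T) (x : T) : R :=
  if n is n'.+1 then rademacher n' (half E) x + rademacher n' (rest E) x
  else msize mu (rest E) / msize mu E * \1_(half E) x +
       - (msize mu (half E) / msize mu E) * \1_(rest E) x.

(** The induction step shared by the statements about [rademacher]. *)
Lemma subset_halves (P : set T -> Prop) :
  (forall E, measurable E -> E `<=` B -> P E) ->
  forall E, measurable E -> E `<=` B -> P (half E) /\ P (rest E).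
Proof.
move=> PP E mE EB; have [mF FE _ _] := halfP mE EB; split; apply: PP => //.
- exact: subset_trans EB.
- exact: measurableD.
- by apply: subset_trans EB; exact: subDsetl.
Qed.

Lemma rademacher_out n E x : measurable E -> E `<=` B ->
  ~ E x -> rademacher n E x = 0.
Proof.
elim: n E => /= [|n IH] E mE EB Ex; have [mF FE _ _] := halfP mE EB.
  by rewrite !indicE !memNset ?mulr0 ?addr0// => [[]|/FE].
have [IF IG] := subset_halves IH mE EB.
by rewrite IF ?IG ?addr0// => [[]|/FE].
Qed.

Lemma rademacher_half_out n E x : measurable E -> E `<=` B ->
  ~ half E x -> rademacher n (half E) x = 0.
Proof.
move=> mE EB; have [mF FE _ _] := halfP mE EB.
apply: rademacher_out => //; exact: subset_trans EB.
Qed.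

Lemma rademacher_rest_out n E x : measurable E -> E `<=` B ->
  ~ rest E x -> rademacher n (rest E) x = 0.
Proof.
move=> mE EB; have [mF FE _ _] := halfP mE EB.
apply: rademacher_out; first exact: measurableD.
by apply: subset_trans EB; exact: subDsetl.
Qed.

Lemma bounded_on_rademacher n E : measurable E -> E `<=` B ->
  bounded_on (rademacher n E).
Proof.
elim: n E => /= [|n IH] E mE EB; last first.
  by have [? ?] := subset_halves IH mE EB; exact: bounded_onD.
have [? ?] := subset_halves bounded_on_indic mE EB.
by apply: bounded_onD; exact: bounded_onZ.
Qed.

Lemma rademacher_le1 n E x : measurable E -> E `<=` B ->
  `|rademacher n E x| <= 1.
Proof.
elim: n E => /= [|n IH] E mE EB; have [mF FE l u] := halfP mE EB.
  have c1 F : F `<=` E -> measurable F -> `|msize mu F / msize mu E| <= 1.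
    move=> FE' mF'; rewrite ger0_norm; last first.
      by rewrite divr_ge0// msize_ge0.
    have [->|E0] := eqVneq (msize mu E) 0; first by rewrite invr0 mulr0.
    rewrite ler_pdivrMr ?mul1r ?lt_neqAle ?msize_ge0 1?eq_sym ?E0//.
    exact: (le_msize mB fB).
  have [Fx|nFx] := pselect (half E x).
    rewrite !indicE mem_set// memNset ?mulr0 ?addr0 ?mulr1; last by case.
    by apply: c1; [exact: subDsetl|exact: measurableD].
  rewrite !indicE memNset// mulr0 add0r.
  have [Ex|nEx] := pselect (E x).
    by rewrite mem_set// mulr1 normrN; exact: c1.
  by rewrite memNset ?mulr0 ?normr0// => -[].
have [IHF IHG] := subset_halves IH mE EB.
have [Fx|nFx] := pselect (half E x).
  by rewrite (@rademacher_rest_out _ E) ?addr0// => -[].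
by rewrite (@rademacher_half_out _ E) ?add0r.
Qed.

Lemma integral_rademacher n E : measurable E -> E `<=` B ->
  Int (rademacher n E) = 0.
Proof.
elim: n E => /= [|n IH] E mE EB; last first.
  have [? ?] := subset_halves (@bounded_on_rademacher n) mE EB.
  rewrite integral_bounded_onD//.
  by have [-> ->] := subset_halves IH mE EB; rewrite addr0.
have [? ?] := subset_halves bounded_on_indic mE EB.
have [mF _ _ _] := halfP mE EB.
rewrite integral_bounded_onD ?integral_bounded_onZ//; [|exact: bounded_onZ..].
rewrite !integral_bounded_on_indic//; last exact: measurableD.
by rewrite mulNr mulrAC [X in _ - X]mulrAC [X in _ - X / _]mulrC subrr.
Qed.

Lemma rademacher_cross n m E x : measurable E -> E `<=` B ->
  rademacher n (half E) x * rademacher m (rest E) x = 0.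
Proof.
move=> mE EB; have [Fx|nFx] := pselect (half E x).
  by rewrite (@rademacher_rest_out _ E) ?mulr0// => -[].
by rewrite (@rademacher_half_out _ E) ?mul0r.
Qed.

(** On the pieces where the coarser function is constant, the finer one has mean
    zero. *)
Lemma rademacher_orthogonal n m E : (n < m)%N -> measurable E -> E `<=` B ->
  Int (fun x => rademacher n E x * rademacher m E x) = 0.
Proof.
elim: n m E => [|n IH] [|m]// E nm mE EB /=.
  have [bF bG] := subset_halves (@bounded_on_rademacher m) mE EB.
  have [iF iG] := subset_halves (@integral_rademacher m) mE EB.
  have [mF FE _ _] := halfP mE EB.
  set a := _ / _; set b := - _.
  transitivity (Int (fun x => a * rademacher m (half E) x + b * rademacher m (rest E) x)).
    apply: eq_Rintegral => x _.
    have [Fx|nFx] := pselect (half E x).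
      rewrite (@rademacher_rest_out _ E)// => [|[]//].
      by rewrite !indicE mem_set// memNset ?mulr0 ?addr0 ?mulr1// => -[].
    rewrite (@rademacher_half_out _ E)// !indicE (memNset nFx) !mulr0 !add0r.
    have [Gx|nGx] := pselect (rest E x); first by rewrite mem_set// mulr1.
    by rewrite (@rademacher_rest_out _ E)// !mulr0.
  rewrite integral_bounded_onD; [|exact: bounded_onZ..].
  by rewrite !integral_bounded_onZ// iF iG !mulr0 addr0.
have [bF bG] := subset_halves (@bounded_on_rademacher m) mE EB.
have [bF' bG'] := subset_halves (@bounded_on_rademacher n) mE EB.
have [iF iG] := subset_halves (fun E => @IH m E nm) mE EB.
transitivity (Int (fun x => rademacher n (half E) x * rademacher m (half E) x +
    rademacher n (rest E) x * rademacher m (rest E) x)).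
  apply: eq_Rintegral => x _; have := rademacher_cross n m x mE EB.
  have := rademacher_cross m n x mE EB; rewrite mulrDl !mulrDr => + ->.
  by rewrite mulrC => ->; rewrite addr0 add0r.
rewrite integral_bounded_onD ?iF ?iG ?addr0//; exact: bounded_onM.
Qed.

(** If a cell of measure [e] is cut into pieces of measures [f] and [e - f], the
    absolute value integrates to [2 * f * (e - f) / e] over it, and [f] lies
    between [e / 3] and [2 * e / 3]. *)
Lemma rademacher_norm_ge n E : measurable E -> E `<=` B ->
  2 / 9 * msize mu E <= Int (fun x => `|rademacher n E x|).
Proof.
elim: n E => /= [|n IH] E mE EB; have [mF FE l u] := halfP mE EB.
  have [bF bG] := subset_halves bounded_on_indic mE EB.
  set a := msize mu (rest E) / msize mu E.
  set b := msize mu (half E) / msize mu E.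
  have a0 : 0 <= a by rewrite divr_ge0 ?msize_ge0.
  have b0 : 0 <= b by rewrite divr_ge0 ?msize_ge0.
  rewrite [leRHS](_ : _ = Int (fun x => a * \1_(half E) x + b * \1_(rest E) x)); last first.
    apply: eq_Rintegral => x _; have [Fx|nFx] := pselect (half E x).
      rewrite !indicE mem_set// memNset ?mulr0 ?addr0 ?mulr1 ?ger0_norm//.
      by case.
    rewrite !indicE (memNset nFx) !mulr0 !add0r mulNr normrN ger0_norm//.
    by rewrite mulr_ge0.
  rewrite integral_bounded_onD ?integral_bounded_onZ//; [|exact: bounded_onZ..].
  rewrite !integral_bounded_on_indic//; last exact: measurableD.
  rewrite /a /b (msizeD mB fB)//.
  move: (msize_ge0 mu E) l u; set e := msize mu E; set f := msize mu (half E).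
  rewrite le_eqVlt => /predU1P[<-|e0] l u; first by rewrite !invr0 !mulr0 !mul0r addr0.
  rewrite (_ : _ + _ = 2 * f * (e - f) / e); last by ring.
  rewrite ler_pdivlMr//.
  have : 0 <= (3 * f - e) * (2 * e - 3 * f) by rewrite mulr_ge0 ?subr_ge0.
  nra.
have [bF bG] := subset_halves (@bounded_on_rademacher n) mE EB.
have [iF iG] := subset_halves IH mE EB.
rewrite [leRHS](_ : _ = Int (fun x => `|rademacher n (half E) x| + `|rademacher n (rest E) x|)).
  rewrite integral_bounded_onD; [|exact: bounded_on_abs..].
  by move: iF iG; rewrite (msizeD mB fB)//; lra.
apply: eq_Rintegral => x _; have /eqP := rademacher_cross n n x mE EB.
by rewrite mulf_eq0 => /orP[] /eqP ->; rewrite normr0 ?addr0 ?add0r.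
Qed.

End rademacher.

(** * Weak nullity of the Rademacher functions *)

Section atomless_not_schur.
Context d (T : measurableType d) (R : realType).
Variable mu : {measure set T -> \bar R}.
Variable B : set T.
Hypotheses (mB : measurable B) (fB : (mu B < +oo)%E) (atB : atomless mu B).
Local Notation L1 := (LspaceType1 mu).
Local Notation Int f := (\int[mu]_x f x).

Let r n : T -> R := rademacher mB fB atB n B.

Let br n : bounded_on B (r n).
Proof. exact: bounded_on_rademacher. Qed.

Definition rademacher_L1 n : L1 := L1_of (bounded_on_integrable mB fB (br n)).

Lemma rademacher_L1E n : (rademacher_L1 n : T -> R) = r n %[ae mu].
Proof. exact: L1_ofE. Qed.

Lemma rademacher_L1_norm_ge n : 2 / 9 * msize mu B <= `|rademacher_L1 n|.
Proof.
rewrite (L1_norm_eq _ (rademacher_L1E n)); last by have [] := br n.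
exact: rademacher_norm_ge.
Qed.

Section combination.
Variable c : nat -> R.

Fixpoint rademacher_comb N (x : T) : R :=
  if N is n.+1 then rademacher_comb n x + c n * r n x else 0.

Lemma bounded_on_comb N : bounded_on B (rademacher_comb N).
Proof.
elim: N => [|N IH].
  split => //; first exact: measurable_cst.
  by exists 0 => x; rewrite normr0.
by apply: bounded_onD => //; exact: bounded_onZ.
Qed.

Lemma rademacher_combE N :
  ((\sum_(0 <= k < N) c k *: rademacher_L1 k : L1) : T -> R) = rademacher_comb N %[ae mu].
Proof.
elim: N => [|N IH]; first by rewrite big_nil; exact: L1_zeroE.
rewrite big_nat_recr//=.
have := L1_addE (\sum_(0 <= k < N) c k *: rademacher_L1 k) (c N *: rademacher_L1 N).
move: (L1_scaleE (c N) (rademacher_L1 N)) (rademacher_L1E N) IH => h1 h2 h3 h4.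
apply: filterS2 (filterI h1 h2) (filterI h3 h4).
by move=> x /= [/(_ I) e1 /(_ I) e2] [/(_ I) e3 /(_ I) e4] _; rewrite e4 /= e3 e1 e2.
Qed.

Lemma rademacher_comb_orthogonal N m : (N <= m)%N -> Int (fun x => rademacher_comb N x * r m x) = 0.
Proof.
elim: N => [|N IH] Nm /=.
  rewrite [LHS](_ : _ = Int (fun=> 0)); last by apply: eq_Rintegral => x _; rewrite mul0r.
  by rewrite -[RHS](mul0r (fine (mu setT))) Rintegral_cst.
transitivity (Int (fun x => rademacher_comb N x * r m x + c N * (r N x * r m x))).
  by apply: eq_Rintegral => x _; rewrite mulrDl mulrA.
rewrite (integral_bounded_onD mB fB).
- rewrite IH ?(ltnW Nm)// (integral_bounded_onZ mB fB); last exact: bounded_onM.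
  by rewrite rademacher_orthogonal// mulr0 addr0.
- exact: bounded_onM (bounded_on_comb N) (br m).
- exact: bounded_onZ (bounded_onM (br N) (br m)).
Qed.

Lemma rademacher_comb_square_le N :
  Int (fun x => rademacher_comb N x * rademacher_comb N x) <= msize mu B * \sum_(0 <= k < N) c k ^+ 2.
Proof.
elim: N => [|N IH] /=.
  rewrite [leLHS](_ : _ = Int (fun=> 0)); last by apply: eq_Rintegral => x _; rewrite mul0r.
  by rewrite Rintegral_cst// mul0r big_nil mulr0.
rewrite big_nat_recr//= mulrDr.
have bc := bounded_on_comb N; have b := br N.
rewrite [leLHS](_ : _ = Int (fun x => rademacher_comb N x * rademacher_comb N x +
    (2 * c N * (rademacher_comb N x * r N x) + c N ^+ 2 * (r N x * r N x)))); last first.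
  by apply: eq_Rintegral => x _; ring.
have bcr := bounded_onM bc b; have bcc := bounded_onM bc bc.
have brr := bounded_onM b b.
rewrite (integral_bounded_onD mB fB bcc (bounded_onD (bounded_onZ _ bcr) (bounded_onZ _ brr))).
rewrite (integral_bounded_onD mB fB (bounded_onZ _ bcr) (bounded_onZ _ brr)).
rewrite !(integral_bounded_onZ mB fB)// rademacher_comb_orthogonal// mulr0 add0r.
rewrite lerD// mulrC ler_wpM2r ?sqr_ge0//.
rewrite -(integral_bounded_on_indic _ mB).
apply: (integral_bounded_on_le mB fB) => //; first exact: bounded_on_indic.
move=> x /=; rewrite indicE; have [Bx|nBx] := pselect (B x).
  rewrite mem_set// -expr2 -real_normK ?num_real// expr_le1//.
  exact: rademacher_le1.
by rewrite memNset// /r rademacher_out// mul0r.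
Qed.

(** The inequality of Cauchy and Schwarz between the norms of [L1] and [L2] on
    [B], in additive form: integrate [2 * `|g| <= t + g ^+ 2 / t]. *)
Lemma rademacher_comb_norm_le N t : 0 < t ->
  2 * `|\sum_(0 <= k < N) c k *: rademacher_L1 k : L1| <=
  t * msize mu B + t^-1 * (msize mu B * \sum_(0 <= k < N) c k ^+ 2).
Proof.
move=> t0; have bc := bounded_on_comb N; have bcc := bounded_onM bc bc.
rewrite (L1_norm_eq _ (rademacher_combE N)); last by have [] := bc.
apply: (@le_trans _ _ (t * msize mu B +
  t^-1 * Int (fun x => rademacher_comb N x * rademacher_comb N x))); last first.
  by rewrite lerD2l ler_wpM2l ?invr_ge0 ?(ltW t0)// rademacher_comb_square_le.
have b1 : bounded_on B (\1_B : T -> R) by exact: bounded_on_indic.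
rewrite -(integral_bounded_on_indic mu mB).
rewrite -!(integral_bounded_onZ mB fB)//; last exact: bounded_on_abs.
rewrite -(integral_bounded_onD mB fB (bounded_onZ t b1) (bounded_onZ t^-1 bcc)).
have babs := bounded_onZ 2 (bounded_on_abs bc).
apply: (integral_bounded_on_le mB fB babs (bounded_onD (bounded_onZ t b1) (bounded_onZ t^-1 bcc))).
move=> x /=; rewrite indicE; have [Bx|nBx] := pselect (B x); last first.
  have [_ -> // _] := bc; rewrite memNset// normr0 !mulr0 addr0//.
have -> : rademacher_comb N x * rademacher_comb N x = `|rademacher_comb N x| ^+ 2.
  by rewrite real_normK ?num_real.
rewrite mem_set// mulr1 -(ler_pM2l t0) mulrDr mulVKf ?gt_eqF//.
have := sqr_ge0 (t - `|rademacher_comb N x|); nra.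
Qed.

End combination.

(** Bessel's inequality: if [a k] are the values of a functional at the Rademacher
    functions, the sum of [a k ^+ 2] over [k < N] is the value of the functional
    at the combination with coefficients [a], whose norm is at most a multiple
    of the square root of that same sum.  So the sums stay bounded. *)
Lemma rademacher_weakly_null : weakly_null rademacher_L1.
Proof.
move=> phi [M phiM]; pose a k : R := phi (rademacher_L1 k).
pose b := msize mu B; have b0 : 0 <= b by exact: msize_ge0.
pose K : R := `|M| + 1; have K0 : 0 < K by rewrite ltr_wpDl.
have phiK x : phi x <= K * `|x|.
  rewrite (le_trans (ler_norm _))// (le_trans (phiM x))// ler_wpM2r//.
  by rewrite (le_trans (ler_norm _))// lerDl.
have sumE N : \sum_(0 <= k < N) a k ^+ 2 =
    phi (\sum_(0 <= k < N) a k *: rademacher_L1 k).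
  rewrite linear_sum; apply: eq_bigr => k _.
  by rewrite linearZ.
have bound N : \sum_(0 <= k < N) a k ^+ 2 <= K ^+ 2 * (b + 1) ^+ 2.
  have := phiK (\sum_(0 <= k < N) a k *: rademacher_L1 k); rewrite -sumE.
  set S := \sum_(0 <= k < N) _.
  have S0 : 0 <= S by apply: sumr_ge0 => k _; exact: sqr_ge0.
  have t0 : 0 < K * (b + 1) by rewrite mulr_gt0// ltr_wpDl.
  (* This [t] makes the quadratic term of the estimate at most [S / K], which
     leaves half of the sum [S] to be bounded; [b + 1] keeps it positive. *)
  have := rademacher_comb_norm_le a N t0; rewrite -/S -/b.
  set X := `|_|; move=> hX SX.
  have h1 : K * ((K * (b + 1))^-1 * (b * S)) <= S.
    rewrite invfM !mulrA mulfV ?gt_eqF// mul1r.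
    by rewrite ler_piMl// mulrC ler_pdivrMr ?ltr_wpDl// mul1r lerDl.
  have h2 : K * (2 * X) <= K * (K * (b + 1) * b) + S.
    by apply: le_trans (ler_wpM2l (ltW K0) hX) _; rewrite mulrDr lerD2l.
  have h3 : K * (K * (b + 1) * b) <= K ^+ 2 * (b + 1) ^+ 2.
    rewrite [leLHS](_ : _ = K ^+ 2 * ((b + 1) * b)); last by ring.
    by rewrite ler_wpM2l ?sqr_ge0//; nra.
  lra.
have /cvg_series_cvg_0 : cvgn (series (fun k => a k ^+ 2)).
  apply: nondecreasing_is_cvgn.
    by apply/nondecreasing_series => k _ _; exact: sqr_ge0.
  by exists (K ^+ 2 * (b + 1) ^+ 2) => _ [N _ <-]; exact: bound.
move=> a20; apply/cvgrPdist_lt => e e0.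
have e20 : 0 < e ^+ 2 by rewrite exprn_gt0.
have /cvgrPdist_lt/(_ _ e20) := a20.
apply: filterS => n; rewrite !sub0r !normrN ger0_norm ?sqr_ge0//.
by rewrite -(real_normK (num_real _)) ltr_pXn2r// nnegrE ltW.
Qed.

Lemma schur_atomless_null : schur_property L1 -> mu B = 0.
Proof.
move=> /(_ _ rademacher_weakly_null) /cvgrPdist_lt r0.
rewrite (msizeE mB fB mB (@subset_refl _ _)); congr EFin.
apply/eqP; rewrite eq_le msize_ge0 andbT leNgt; apply/negP => B0.
have e0 : 0 < 2 / 9 * msize mu B by rewrite mulr_gt0.
have [N _ /(_ N (leqnn N))] := r0 _ e0.
by rewrite /= sub0r normrN ltNge rademacher_L1_norm_ge.
Qed.

End atomless_not_schur.

(** * Atomic supports and the equivalence *)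

Section schur_gelfand_phillips.
Context d (T : measurableType d) (R : realType).
Variable mu : {measure set T -> \bar R}.
Local Notation L1 := (LspaceType1 mu).

(** The largest atomically covered part of [B] leaves an atomless remainder, which
    the Schur property forces to be null. *)
Lemma schur_atomically_covered B : schur_property L1 ->
  measurable B -> (mu B < +oo)%E -> atomically_covered mu B.
Proof.
move=> schur mB fB.
pose C E := [/\ measurable E, E `<=` B & atomically_covered mu E].
have [E [mE EB _]|||P [mP PB [a [ata Pa]]] Pmax] := @exhaustion _ _ _ mu B mB fB C.
- by [].
- by split => //; apply: atomically_covered_atom; exact: almost_atom0.
- move=> E CE; split.
  + by apply: bigcup_measurable => n _; have [] := CE n.
  + by apply: bigcup_sub => n _; have [] := CE n.
  + by apply: atomically_covered_bigcup => n; have [] := CE n.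
have mQ : measurable (B `\` P) by exact: measurableD.
have fQ : (mu (B `\` P) < +oo)%E.
  by apply: le_lt_trans fB; apply: le_measure; rewrite ?inE//; exact: subDsetl.
have atQ : atomless mu (B `\` P).
  move=> A atA AQ; have [mA _] := atA.
  rewrite -(Pmax A); last first.
    split => //; first by apply: subset_trans AQ _; exact: subDsetl.
    exact: atomically_covered_atom.
  by rewrite setDidl//; apply/disjoints_subset => x /AQ[].
have Q0 := schur_atomless_null mQ fQ atQ schur.
exists a; split => //.
apply: (@negligibleS _ _ _ _ ((P `\` \bigcup_i a i) `|` (B `\` P))).
  move=> x [Bx ax]; have [Px|nPx] := pselect (P x); first by left.
  by right.
by apply: negligibleU => //; apply/negligibleP.
Qed.

(** The support of an integrable function is a countable union of sets of finite
    measure, by Markov's inequality. *)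
Lemma schur_support_covered (f : L1) : schur_property L1 ->
  atomically_covered mu [set x | f x != 0].
Proof.
move=> schur; have mf := measurable_L1 f.
pose F k := [set x | k.+1%:R^-1 <= `|f x|].
have -> : [set x | f x != 0] = \bigcup_k F k.
  apply/seteqP; split => [x /=|x [k _]]; rewrite /= -normr_gt0.
    by move=> /ltr_add_invr[k]; rewrite add0r => /ltW; exists k.
  by rewrite /F/=; apply: lt_le_trans; rewrite invr_gt0.
apply: atomically_covered_bigcup => k.
have mF : measurable (F k).
  rewrite (_ : F k = (fun x => `|f x|) @^-1` `[k.+1%:R^-1, +oo[); last first.
    by apply/seteqP; split => x /=; rewrite in_itv/= andbT.
  by rewrite -[_ @^-1` _]setTI; apply: (measurableT_comp _ mf).
apply: schur_atomically_covered => //.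
have k0 : 0 < k.+1%:R^-1 :> R by rewrite invr_gt0.
have /integrableP[mEf fin] := L1_integrable f.
have := le_integral_abse mu measurableT mEf k0; rewrite setTI => markov.
rewrite ltey; apply/eqP => Foo; have := le_lt_trans markov fin.
by rewrite [mu _]Foo gt0_muley ?lte_fin// ltxx.
Qed.

Lemma schur_atomic_sequence (x : nat -> L1) : schur_property L1 ->
  exists a : nat -> set T, [/\ trivIset [set: nat] a,
    forall i, almost_atom mu (a i) &
    forall n, (x n : T -> R) = cst 0 %[ae mu in ~` (\bigcup_i a i)]].
Proof.
move=> schur.
have [a [ata aS]] := atomically_covered_bigcup (fun n => schur_support_covered (x n) schur).
exists (seqDU a); split.
- exact: trivIset_seqDU.
- move=> i; apply: almost_atomS (ata i); last exact: subDsetl.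
  apply: measurableD; first exact: (ata i).1.
  by apply: bigsetU_measurable => j _; exact: (ata j).1.
- move=> n; rewrite -seqDU_bigcup_eq; apply: negligibleS aS => y /=.
  move=> /not_implyP[Uy xy]; split => //; exists n => //=.
  exact/eqP.
Qed.

(** For each sequence of [A] there is one operator into [ell1] that preserves all
    mutual distances of its terms. *)
Lemma schur_gelfand_phillips :
  schur_property L1 -> coarse_1_gelfand_phillips L1.
Proof.
move=> schur A limA; apply: precompact_of_seq => x Ax e e0.
have [a [ta ata xa]] := schur_atomic_sequence x schur.
have ma i := (ata i).1.
pose S := L1_pieces mu ma ta.
have e20 : 0 < e / 2 by rewrite divr_gt0.
have SA : precompact (S @` A) by apply: limA; exact: L1_pieces_bounded.
have Sx n : (S @` A) (S (x n)) by exists (x n).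
have [y /(_ _ e20) yS] := precompact_cluster_seq SA Sx.
have [n _ yn] := yS 0%N; have [m nm ym] := yS n.+1.
exists n, m; split => //.
rewrite -(L1_pieces_isometry ma ta)//; last first.
  move: (L1_subE (x n) (x m)) (xa n) (xa m).
  apply: filterS3 => z /(_ Logic.I) /= -> xn xm /[dup] /xn -> /xm ->.
  by rewrite subr0.
rewrite linearB/= -(subrKA y) (le_lt_trans (ler_normD _ _))// [ltRHS]splitr.
by rewrite ltrD// distrC.
Qed.

(** Operators into [ell1] map weakly null sequences to norm null ones, so the range
    of a weakly null sequence is coarse 1-limited, hence precompact.  Its cluster
    points are annihilated by all integrals over measurable sets, so zero is the
    only one. *)
Lemma gelfand_phillips_schur :
  coarse_1_gelfand_phillips L1 -> schur_property L1.
Proof.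
move=> GP u wu.
have : precompact (range u).
  apply: GP => S [M SM].
  rewrite image_comp.
  apply: (@precompact_range_cvg _ _ (S \o u) 0).
  apply: ell1_schur => phi [N phiN].
  apply: (wu (phi \o S : {linear L1 -> R^o})).
  exists (`|N| * M) => x /=.
  rewrite (le_trans (phiN _))// -mulrA.
  apply: (@le_trans _ _ (`|N| * `|S x|)).
    by rewrite ler_wpM2r// ler_norm.
  by rewrite ler_wpM2l.
move=> prec; apply: contrapT => nu.
have [e e0 /choice[s /all_and2[sn eu]]] : exists2 e : R, 0 < e &
    forall N, exists n, (N <= n)%N /\ e <= `|u n|.
  apply: contrapT => ne; apply: nu; apply/cvgrPdist_lt => e e0.
  apply: contrapT => nev; apply: ne; exists e => // N.
  apply: contrapT => nN; apply: nev; exists N => // n /= Nn.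
  by rewrite sub0r normrN ltNge; apply/negP => en; apply: nN; exists n.
have us n : range u (u (s n)) by exists (s n).
have [y yu] := precompact_cluster_seq prec us.
have y0 : y = 0.
  apply: L1_int_eq0 => E mE; apply/eqP; rewrite -normr_le0.
  apply/ler_addgt0Pr => eps eps0; rewrite add0r.
  have eps20 : 0 < eps / 2 by rewrite divr_gt0.
  have /cvgrPdist_lt/(_ _ eps20)[N _ uN] := wu _ (L1_int_bounded mu mE).
  have [n Nn yn] := yu _ eps20 N.
  have := uN (s n) (leq_trans Nn (sn n)); rewrite sub0r normrN.
  rewrite -[X in _ -> `|X| <= _]/(L1_int mu mE y) -(subrK (u (s n)) y) linearD.
  move=> small; rewrite (le_trans (ler_normD _ _))// [leRHS]splitr lerD// ?ltW//.
  apply: le_lt_trans yn.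
  apply: le_trans (L1_set_norm_le _ mE).
  by apply: le_normr_Rintegral => //; exact: L1_integrableS.
have [n _] := yu e e0 0%N.
by rewrite y0 sub0r normrN ltNge eu.
Qed.

End schur_gelfand_phillips.

Theorem mainTheorem3 (d : measure_display) (T : measurableType d)
    (R : realType) (mu : {measure set T -> \bar R}) :
  coarse_1_gelfand_phillips (LspaceType1 mu) <-> schur_property (LspaceType1 mu).
Proof.
split; [exact: gelfand_phillips_schur|exact: schur_gelfand_phillips].
Qed.
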